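(* Let $T$ be a tree, let $B(T)$ be a blow-up of $T$, and let $G$ be a connected $B(T)$-tree with an even number of vertices, equipped with a weight function $w:V(G)\to\mathbb{R}_{\ge 0}$. Then Alice wins the graph grabbing game on $G$; that is, Alice, who moves first, has a strategy that guarantees her at least half of the total weight $\sum_{v\in V(G)}w(v)$.
   Context: All graphs are finite and simple. Graph grabbing game: it is played on a connected graph $G$ with non-negative vertex weights $w:V(G)\to\mathbb{R}_{\ge 0}$ by two players, Alice and Bob, who move alternately, Alice first. In each move the player claims a vertex $v$ of the remaining graph that is not a cut vertex of it (i.e. deleting $v$ leaves a connected graph; the empty graph counts as connected, so the last vertex may be claimed), collects $w(v)$, and $v$ is deleted. The game ends when all vertices have been claimed. Each player wants to maximize the total weight of the vertices he or she claimed. Alice wins the game on $G$ if, under optimal play, she gains at least half of the total weight. Blow-up: for a graph $F$ with vertices $v_1,\dots,v_k$ and pairwise disjoint non-empty finite sets $V_1,\dots,V_k$, the blow-up $B(F)$ is the graph with vertex set $V_1\cup\dots\cup V_k$ in which $x\in V_i$ and $y\in V_j$ are adjacent if and only if $v_i$ and $v_j$ are adjacent in $F$ (in particular each $V_i$ is an independent set). A blow-up of $F$ is any graph obtained in this way. $H$-tree: for a graph $H$ on vertex set $[m]=\{1,\dots,m\}$ and pairwise disjoint trees $T_1,\dots,T_m$ (each with at least one vertex, and disjoint from $H$), an $H$-tree is a graph obtained from $H$ by identifying, for each $i\in[m]$, vertex $i$ of $H$ with exactly one vertex of $T_i$. A $B(T)$-tree is an $H$-tree with $H=B(T)$. *)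

(* Defs.v *)
From mathcomp Require Import all_boot all_order all_algebra.
From mathcomp Require Import reals.

Set Implicit Arguments.
Unset Strict Implicit.
Unset Printing Implicit Defensive.

Import GRing.Theory Num.Theory.
Local Open Scope ring_scope.

Record sgraph := SGraph {
  vertex :> finType;
  adj : rel vertex;
  adj_sym : symmetric adj;
  adj_irr : irreflexive adj }.

Arguments adj {s} x y.
Notation "x -- y" := (adj x y) (at level 30, no associativity).

Definition graph_iso (G H : sgraph) : Prop :=
  exists2 f : G -> H, bijective f & forall x y, (f x -- f y) = (x -- y).

(* The subgraph of G induced by A is connected; this holds for A = set0. *)
Definition connected_in (G : sgraph) (A : {set G}) : bool :=
  [forall x in A, forall y in A,
    connect [rel u v | [&& u \in A, v \in A & u -- v]] x y].

Definition connected (G : sgraph) : bool := connected_in [set: G].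

Definition acyclic (G : sgraph) : Prop :=
  forall c : seq G, uniq c -> cycle adj c -> (size c <= 2)%N.

Definition is_tree (G : sgraph) : Prop :=
  [/\ (0 < #|G|)%N, connected G & acyclic G].

Section Blowup.
Variables (F : sgraph) (V : F -> finType).

(* Taking the vertices to be the pairs (i, x) with x : V i makes the classes
   pairwise disjoint. *)
Definition blowup_adj (x y : {i : F & V i}) : bool := tag x -- tag y.

Lemma blowup_sym : symmetric blowup_adj.
Proof. by move=> x y; rewrite /blowup_adj adj_sym. Qed.

Lemma blowup_irr : irreflexive blowup_adj.
Proof. by move=> x; rewrite /blowup_adj adj_irr. Qed.

Definition blowup : sgraph := SGraph blowup_sym blowup_irr.

End Blowup.

Definition is_blowup (F B : sgraph) : Prop :=
  exists V : F -> finType,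
    (forall i, (0 < #|V i|)%N) /\ graph_iso B (blowup V).

Section HTree.
Variables (H : sgraph) (T : H -> sgraph) (r : forall i, T i).

(* The vertices are those of the disjoint union of the T i; the vertex i of H
   is identified with r i. So two vertices are adjacent if they are adjacent in
   a common T i (tagged_as x y is y transported to the fibre of x), or if they
   are the identified vertices r i and r j with i, j adjacent in H. *)
Definition htree_adj (x y : {i : H & T i}) : bool :=
  (tag x == tag y) && (tagged x -- tagged_as x y)
  || [&& tagged x == r (tag x), tagged y == r (tag y) & tag x -- tag y].

Lemma htree_sym : symmetric htree_adj.
Proof.
move=> [i x] [j y]; rewrite /htree_adj /=.
congr (_ || _); last by rewrite andbCA [j -- i]adj_sym.
have [eq_ij|//] := eqVneq i j.
by case: j / eq_ij y => y; rewrite !tagged_asE /= adj_sym.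
Qed.

Lemma htree_irr : irreflexive htree_adj.
Proof.
by move=> [i x]; rewrite /htree_adj /= tagged_asE !adj_irr !andbF.
Qed.

Definition htree : sgraph := SGraph htree_sym htree_irr.

End HTree.

Definition is_htree (H G : sgraph) : Prop :=
  exists (T : H -> sgraph) (r : forall i, T i),
    (forall i, is_tree (T i)) /\ graph_iso G (htree r).

Section Game.
Variables (R : realType) (G : sgraph) (w : G -> R).

Definition claimable (A : {set G}) (v : G) : bool :=
  (v \in A) && connected_in (A :\ v).

(* A (partial) play is recorded as the sequence of claimed vertices, in
   chronological order; Alice makes the moves of even rank 0, 2, 4, etc. *)
Definition remaining (p : seq G) : {set G} := [set v | v \notin p].

Definition play (p : seq G) : Prop :=
  forall q v, prefix (rcons q v) p -> claimable (remaining q) v.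

(* A strategy maps a history to the next move; None (no move) is needed for
   the type to be inhabited when G is empty. *)
Definition strategy : Type := seq G -> option G.

Definition alice_follows (s : strategy) (p : seq G) : Prop :=
  forall q v, prefix (rcons q v) p -> ~~ odd (size q) -> s q = Some v.

(* The strategy provides a legal move whenever Alice has to move. *)
Definition alice_strategy (s : strategy) : Prop :=
  forall p, play p -> alice_follows s p ->
    ~~ odd (size p) -> remaining p != set0 ->
    exists2 v, s p = Some v & claimable (remaining p) v.

Definition alice_gain (p : seq G) : R :=
  \sum_(v <- p | ~~ odd (index v p)) w v.

Definition alice_guarantees (s : strategy) (c : R) : Prop :=
  forall p, play p -> alice_follows s p -> remaining p = set0 ->
    c <= alice_gain p.

Definition alice_wins : Prop :=
  exists2 s : strategy,
    alice_strategy s & alice_guarantees s ((\sum_v w v) / 2).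

End Game.

(* Main.v *)
Require Import Defs.
From mathcomp Require Import all_boot all_order all_algebra.
From mathcomp Require Import reals.
From mathcomp Require Import lra.

Set Implicit Arguments.
Unset Strict Implicit.
Unset Printing Implicit Defensive.

Import Order.TTheory GRing.Theory Num.Theory.
Local Open Scope ring_scope.

(** Write D(A) for the value (gain of the first player minus gain of the second,
    under optimal play) of the game on a connected set A of vertices ([cval]), and
    D(A; S) for the value of the rooted game ([rval]), in which a set is a legal position
    when every component of it contains a vertex of S. The point is that
    D(G) >= 0: an optimal strategy then gives Alice at least half of the total.

    The rooted game is easy to analyse along a 1-join, that is, a partition
    A = P + Q whose crossing edges are all the pairs from S x S', where the
    attachment sets S and S' lie in P and Q. As long as P is not exhausted, a
    position of the game rooted at S is a pair of a position of the game on P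
    rooted at S and one of the game on Q rooted at S'. Playing first in the part
    with the right parity, and then always answering in the part where the
    opponent has just moved, gives for |A| even: D(A; S) >= D(Q; S') - D(P; S) if
    |P| and |Q| are odd, and D(A; S) >= D(P; S) - D(Q; S') if they are even
    ([rval_joined]).

    The unrooted game is compared with rooted games by induction on |A|
    ([even_bounds], [odd_bounds]). For |A| even, a 1-join gives
    D(A) >= D(P; S) - D(Q; S') when |P| > 1, since a move in P does not exhaust
    it. If both sides have several vertices, the two orders give
    D(A) >= |D(P; S) - D(Q; S')|, hence D(A) >= 0, and also
    D(A) + D(A; S) >= 0. The delicate moves are those which exhaust one side of a
    1-join: after the removal of a single vertex v from v + A one has to compare
    D(A) with D(A; N(v)). The induction then needs two properties of the graph,
    called [decomposable] below. In a connected set A not containing v, the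
    neighbours of v are an attachment set of some 1-join of A if there are at
    least two of them; and if the removal of x from a connected set A disconnects
    it into parts which all meet N(c), where c is not in A, then x and c have the
    same neighbours in A - x.

    Both properties hold in B(T)-trees ([layout_decomposable]), because every
    edge inside an attached tree is a bridge of G, and every edge ij of T, being a
    bridge of T, yields a cut of G crossed only by the edges between the classes
    of i and j. *)

(** * Values of removal games *)

Section Value.
Variables (R : realDomainType) (V : finType) (w : V -> R).
Implicit Types (L : pred {set V}) (A B : {set V}).

(** The value of the game in which the legal positions are the sets in L; n is
    the number of moves to be played. The maximum ranges over a non-empty list
    as long as a legal move exists, and is then independent of its default. *)
Fixpoint value_rec L n A : R :=
  if n is n'.+1 then
    let s := [seq w v - value_rec L n' (A :\ v) | v <- enum A & L (A :\ v)] in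
    \big[Num.max/head 0 s]_(x <- s) x
  else 0.

Definition value L A := value_rec L #|A| A.

Lemma bigmax_head (s : seq R) (m := \big[Num.max/head 0 s]_(x <- s) x) :
  (forall x, x \in s -> x <= m) /\ (s != [::] -> m \in s).
Proof.
rewrite {}/m; have [lem memm] : let m := \big[Num.max/head 0 s]_(x <- s) x in
  (forall x, x \in s -> x <= m) /\ m \in head 0 s :: s.
  elim: s (head 0 s) => [|y s IHs] z /=; first by rewrite big_nil inE eqxx.
  have [le_s mem_s] := IHs z; rewrite big_cons; split=> [x|].
    by rewrite inE le_max => /predU1P[->|/le_s->]; rewrite ?lexx ?orbT.
  rewrite !inE in mem_s *; rewrite /Num.max; case: ifP => _; last by rewrite eqxx orbT.
  by case/orP: mem_s => ->; rewrite ?orbT.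
by split=> //; case: s {lem} memm => //= y s; rewrite !inE => /orP[->|].
Qed.

Lemma value0 L : value L set0 = 0.
Proof. by rewrite /value cards0. Qed.

Lemma value_move L A v :
  v \in A -> L (A :\ v) -> w v - value L (A :\ v) <= value L A.
Proof.
move=> Av Lv; rewrite {2}/value (cardsD1 v A) Av /=.
apply: (bigmax_head _).1; apply/mapP; exists v => //.
by rewrite mem_filter Lv mem_enum.
Qed.

Lemma value_best L A :
    (exists2 v, v \in A & L (A :\ v)) ->
  exists v, [/\ v \in A, L (A :\ v) & value L A = w v - value L (A :\ v)].
Proof.
case=> v0 Av0 Lv0; rewrite /value (cardsD1 v0 A) Av0 /=.
set s := [seq _ | v <- _ & _].
have /(bigmax_head s).2/mapP[v] : s != [::].
  by rewrite -size_eq0 size_map size_filter -lt0n -has_count; apply/hasP;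
     exists v0; rewrite ?mem_enum.
rewrite mem_filter mem_enum => /andP[Lv Av] ->; exists v; split=> //.
congr (_ - value_rec _ _ _); apply/succn_inj; transitivity #|A|.
  by rewrite (cardsD1 v0 A) Av0.
by rewrite (cardsD1 v A) Av.
Qed.

Lemma eq_value L L' A :
  (forall B, B \subset A -> L B = L' B) -> value L A = value L' A.
Proof.
rewrite /value; move: #|A| => n.
elim: n A => [|n IHn] // B eqL /=.
suff -> : [seq w v - value_rec L n (B :\ v) | v <- enum B & L (B :\ v)] =
  [seq w v - value_rec L' n (B :\ v) | v <- enum B & L' (B :\ v)] by [].
have /eq_filter-> : forall v, L (B :\ v) = L' (B :\ v).
  by move=> v; rewrite eqL ?subsetDl.
apply: eq_map => v; rewrite IHn // => C sCB.
by rewrite eqL // (subset_trans sCB) ?subsetDl.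
Qed.

End Value.

(** * Rooted and connected sets *)

Section Rooted.
Variable G : sgraph.
Implicit Types (A B P Q S U : {set G}) (u v x : G).

Definition nbr x : {set G} := [set u | x -- u].

(** Every component of A meets S. This is stated by cuts rather than by paths:
    a non-empty part of A avoiding S is not a union of components of A. *)
Definition rooted S A : bool :=
  [forall U : {set G}, [&& U \subset A, U != set0 & [disjoint U & S]] ==>
    [exists u in U, exists v in A :\: U, u -- v]].

Lemma rootedP S A :
  reflect (forall U, U \subset A -> U != set0 ->
             (forall u, u \in U -> u \notin S) ->
           exists u v, [/\ u \in U, v \in A, v \notin U & u -- v])
          (rooted S A).
Proof.
apply: (iffP forallP) => [rA U sUA U0 US|rA U].
  have /implyP := rA U; rewrite sUA U0 /= => /(_ _)/exists_inP[].
    by apply/pred0P => u /=; case: (boolP (u \in U)) => //= /US/negPf.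
  move=> u Uu /exists_inP[v]; rewrite inE => /andP[vU Av] uv.
  by exists u, v; split.
apply/implyP=> /and3P[sUA U0 /pred0P US].
have [|u [v [Uu Av vU uv]]] := rA U sUA U0.
  by move=> u Uu; have /= := US u; rewrite Uu /= => ->.
by apply/exists_inP; exists u => //; apply/exists_inP; exists v; rewrite // inE vU.
Qed.

Lemma rooted0 S : rooted S set0.
Proof. by apply/rootedP=> U; rewrite subset0 => /eqP->; rewrite eqxx. Qed.

Lemma rooted_meets S A : rooted S A -> A != set0 -> exists2 s, s \in A & s \in S.
Proof.
move=> /rootedP rA A0.
have [s /andP[As Ss]|nAS] := pickP [pred s | (s \in A) && (s \in S)].
  by exists s.
have [u Au|u [v [_ Av]]] := rA A (subxx _) A0; last by rewrite Av.
by have /= := nAS u; rewrite Au /= => ->.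
Qed.

Lemma eq_rooted S S' A :
  (forall u, u \in A -> (u \in S) = (u \in S')) -> rooted S A = rooted S' A.
Proof.
have half S1 S2 : (forall u, u \in A -> (u \in S1) = (u \in S2)) ->
    rooted S1 A -> rooted S2 A.
  move=> eqS /rootedP rA; apply/rootedP=> U sUA U0 US; apply: rA => // u Uu.
  by rewrite eqS ?US ?(subsetP sUA).
by move=> eqS; apply/idP/idP; apply: half => // u Au; rewrite eqS.
Qed.

(** A maximal rooted proper subset M of A misses exactly one vertex: a vertex
    of A outside M that lies in S or has a neighbour in M can be added to M. *)
Lemma rooted_accessible S A :
  rooted S A -> A != set0 -> exists2 v, v \in A & rooted S (A :\ v).
Proof.
move=> rA A0; have: rooted S set0 && (set0 \proper A) by rewrite rooted0 proper0.
case/(@arg_maxnP _ _ [pred M : {set G} | rooted S M && (M \proper A)] (fun M => #|M|)).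
move=> M /= /andP[rM /properP[sMA [z Az zM]]] maxM.
have [v [Av vM vS]] : exists v, [/\ v \in A, v \notin M &
    v \in S \/ exists2 m, m \in M & v -- m].
  have [v /and3P[Av vM Sv]|nS] :=
      pickP [pred v | [&& v \in A, v \notin M & v \in S]].
    by exists v; split; last left.
  have [||u|u [m [uU Am mU um]]] := rootedP _ _ rA (A :\: M); first exact: subsetDl.
    by apply/set0Pn; exists z; rewrite inE zM.
    by rewrite inE => /andP[uM Au]; have /= := nS u; rewrite Au uM /= => ->.
  move: uU mU; rewrite !inE Am andbT negbK => /andP[uM Au] mM.
  by exists u; split=> //; right; exists m.
have rvM : rooted S (v |: M).
  apply/rootedP=> U sU U0 US; have [UM0|UM0] := eqVneq (U :&: M) set0; last first.
    have [||u|u [m]] := rootedP _ _ rM (U :&: M); rewrite ?subsetIr //.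
      by rewrite inE => /andP[/US].
    rewrite !inE => -[/andP[Uu _] Mm]; rewrite Mm andbT => mU um.
    by exists u, m; rewrite !inE Mm orbT.
  have Uv u : u \in U -> u = v.
    move=> Uu; have /setU1P[//|Mu] := subsetP sU u Uu.
    by have := in_set0 u; rewrite -UM0 inE Uu Mu.
  have [u Uu] := set0Pn _ U0; have vU := Uu; rewrite {}(Uv _ Uu) in vU.
  case: vS => [Sv|[m Mm vm]]; first by have := US _ vU; rewrite Sv.
  exists v, m; rewrite !inE Mm orbT; split=> //.
  by apply: contra vM => /Uv <-.
exists v => //; have [sAvM|nsAvM] := boolP (A \subset v |: M).
  suff -> : A :\ v = M by [].
  apply/eqP; rewrite eqEsubset subsetD1 sMA vM !andbT.
  apply/subsetP=> u; rewrite !inE => /andP[uv Au].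
  by have := subsetP sAvM u Au; rewrite !inE (negPf uv).
have := maxM (v |: M); rewrite /= rvM properE nsAvM subUset sub1set Av sMA.
by rewrite cardsU1 vM => /(_ isT); rewrite add1n ltnn.
Qed.

(** Connectedness in the same style, so that both kinds of games are handled by
    the same cut arguments; see [connected_inE]. *)
Definition conn A : bool := [forall s in A, rooted [set s] A].

Lemma connP A :
  reflect (forall U, U \subset A -> U != set0 ->
             forall z, z \in A -> z \notin U ->
           exists u v, [/\ u \in U, v \in A, v \notin U & u -- v])
          (conn A).
Proof.
apply: (iffP forall_inP) => [cA U sUA U0 z Az zU|cA s As].
  apply: (rootedP _ _ (cA z Az) U) => // u Uu; rewrite inE.
  by apply: contraNneq zU => <-.
apply/rootedP=> U sUA U0 Us; apply: (cA U sUA U0 s) => //.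
by apply/negP=> /Us; rewrite set11.
Qed.

Lemma connected_inE A : connected_in A = conn A.
Proof.
apply/forall_inP/connP => [cA U sUA /set0Pn[x Ux] z Az zU|cA x Ax].
  have /forall_inP/(_ z Az) := cA x (subsetP sUA x Ux).
  have [[u v] /= /and4P[Uu Av vU uv] _|none] :=
      pickP [pred e : G * G | [&& e.1 \in U, e.2 \in A, e.2 \notin U & e.1 -- e.2]].
    by exists u, v.
  case/connectP=> p; elim: p x Ux => [|y p IHp] x Ux /= => [_ zx|].
    by rewrite zx Ux in zU.
  case/andP=> /and3P[Ax Ay xy] pathp zlast; apply: (IHp y) => //.
  by have /= := none (x, y); rewrite Ux Ay xy andbT /= => /negbFE.
apply/forall_inP=> y Ay; set e := [rel u v | _]; apply/idPn=> nxy.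
have [|||u [v []]] := cA [set z in A | connect e x z] _ _ y Ay.
- by apply/subsetP=> z; rewrite inE => /andP[].
- by apply/set0Pn; exists x; rewrite inE Ax connect0.
- by rewrite inE (negPf nxy) andbF.
rewrite !inE => /andP[Au xu] Av; rewrite Av /= => nxv uv; case/negP: nxv.
by apply: connect_trans xu (connect1 _); rewrite /e /= Au Av.
Qed.
End Rooted.

(** * 1-joins *)

Section Joined.
Variable G : sgraph.
Implicit Types (A B P Q S U : {set G}) (u v x c : G).

(** The partition {P, Q} is a 1-join of the graph induced by the union of P and
    Q, with attachment sets S and S'. These are not required to be contained in P
    and Q, so that the property passes to subsets unchanged. *)
Definition joined P S Q S' : Prop :=
  [/\ [disjoint P & Q], [disjoint P & S'], [disjoint Q & S] &
      forall a b, a \in P -> b \in Q -> (a -- b) = (a \in S) && (b \in S')].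

Lemma joined_sym P S Q S' : joined P S Q S' -> joined Q S' P S.
Proof.
case=> dPQ dPS dQS E; split=> // [|b a Qb Pa]; first by rewrite disjoint_sym.
by rewrite adj_sym E // andbC.
Qed.

Lemma joined_sub P Q P' Q' S S' :
  P' \subset P -> Q' \subset Q -> joined P S Q S' -> joined P' S Q' S'.
Proof.
move=> sP sQ [dPQ dPS dQS E]; split.
- exact: disjointWl sP (disjointWr sQ dPQ).
- exact: disjointWl sP dPS.
- exact: disjointWl sQ dQS.
by move=> a b /(subsetP sP)Pa /(subsetP sQ)Qb; apply: E.
Qed.

Lemma joined_nbr x A : x \notin A -> joined [set x] [set x] A (nbr x).
Proof.
move=> xA; split=> [|||a b].
- by rewrite disjoints1.
- by rewrite disjoints1 inE adj_irr.
- by rewrite disjoint_sym disjoints1.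
by rewrite !inE => /eqP-> _; rewrite eqxx.
Qed.

(** A root in P reaches every vertex of Q that lies in S', and Q can reach S only
    through S'. This fails when P is empty, which is what makes the last move in
    P special. *)
Lemma rooted_joined P Q S S' : joined P S Q S' -> P != set0 ->
  rooted S (P :|: Q) = rooted S P && rooted S' Q.
Proof.
case=> dPQ dPS dQS E P0; apply/rootedP/andP.
  move=> rPQ; split; apply/rootedP=> U sU U0 US.
    have [|u [v [Uu]]] := rPQ U _ U0 US; first by rewrite subsetU ?sU.
    rewrite inE => /orP[Pv|Qv] vU uv; first by exists u, v.
    by move: uv; rewrite E ?(subsetP sU) // (negPf (US u Uu)).
  have [||u [v [Uu]]] := rPQ U _ U0; first by rewrite subsetU ?sU ?orbT.
    by move=> u /(subsetP sU)Qu; rewrite (disjointFr dQS Qu).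
  rewrite inE => /orP[Pv|Qv] vU uv; last by exists u, v.
  by move: uv; rewrite adj_sym E ?(subsetP sU) // (negPf (US u Uu)) andbF.
case=> rP rQ U sU U0 US.
have [UP0|UP0] := eqVneq (U :&: P) set0; last first.
  have [||u|u [v [/setIP[Uu Pu] Pv]]] := rootedP _ _ rP (U :&: P) => //.
  - exact: subsetIr.
  - by case/setIP=> /US.
  by rewrite !inE Pv andbT => vU uv; exists u, v; rewrite !inE Pv.
have UP u : u \in U -> u \notin P.
  by move=> Uu; apply/negP=> Pu; have := in_set0 u; rewrite -UP0 inE Uu Pu.
have sUQ : U \subset Q.
  apply/subsetP=> u Uu; have := subsetP sU u Uu.
  by rewrite inE (negPf (UP u Uu)).
have [u /andP[/= Uu S'u]|nS'] := pickP [pred u | (u \in U) && (u \in S')].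
  have [s Ps Ss] := rooted_meets rP P0.
  exists u, s; split=> //; first by rewrite inE Ps.
    by apply/negP=> Us; have := UP s Us; rewrite Ps.
  by rewrite adj_sym E ?Ss // (subsetP sUQ).
have [u|u [v [Uu Qv vU uv]]] := rootedP _ _ rQ U sUQ U0.
  by move=> Uu; have /= := nS' u; rewrite Uu /= => ->.
by exists u, v; rewrite inE Qv orbT.
Qed.

(** With both sides non-empty, all vertices of S and S' in the set are in one
    component, which turns connectedness into two independent conditions. *)
Lemma conn_joined P Q S S' : joined P S Q S' -> P != set0 -> Q != set0 ->
  conn (P :|: Q) = rooted S P && rooted S' Q.
Proof.
move=> joinPQ P0 Q0; have [dPQ dPS dQS E] := joinPQ.
have [dQP dQS' dPS' E'] := joined_sym joinPQ.
apply/connP/andP.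
  move=> cPQ; have [q Qq] := set0Pn _ Q0; have [p Pp] := set0Pn _ P0.
  split; apply/rootedP=> U sU U0 US.
    have [|||u [v [Uu]]] := cPQ U _ U0 q.
    - by rewrite subsetU ?sU.
    - by rewrite inE Qq orbT.
    - by apply: contraTN Qq => /(subsetP sU)/(disjointFr dPQ)->.
    rewrite inE => /orP[Pv|Qv] vU uv; first by exists u, v.
    by move: uv; rewrite E ?(subsetP sU) // (negPf (US u Uu)).
  have [|||u [v [Uu]]] := cPQ U _ U0 p.
  - by rewrite subsetU ?sU ?orbT.
  - by rewrite inE Pp.
  - by apply: contraTN Pp => /(subsetP sU)/(disjointFr dQP)->.
  rewrite inE => /orP[Pv|Qv] vU uv; last by exists u, v.
  by move: uv; rewrite E' ?(subsetP sU) // (negPf (US u Uu)).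
case=> rP rQ U sU U0 z PQz zU.
have rPQ : rooted S (P :|: Q) by rewrite (rooted_joined joinPQ) ?rP.
have [s /andP[/= Us Ss]|nUS] := pickP [pred s | (s \in U) && (s \in S)]; last first.
  by apply: (rootedP _ _ rPQ) => // u Uu; have /= := nUS u; rewrite Uu /= => ->.
pose U' := (P :|: Q) :\: U.
have U'0 : U' != set0 by apply/set0Pn; exists z; rewrite inE zU.
have sU' : U' \subset P :|: Q by apply: subsetDl.
have [s' /andP[/= /setDP[PQs' s'U] Ss']|nUS'] :=
  pickP [pred s | (s \in U') && (s \in S)]; last first.
  have [u Uu|u [v [/setDP[PQu uU] PQv vU' uv]]] := rootedP _ _ rPQ U' sU' U'0.
    by have /= := nUS' u; rewrite Uu /= => ->.
  exists v, u; rewrite adj_sym; split=> //.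
  by move: vU'; rewrite inE PQv andbT negbK.
have inP t : t \in P :|: Q -> t \in S -> t \in P.
  by rewrite inE => /orP[//|/(disjointFr dQS)->].
have Ps := inP s (subsetP sU s Us) Ss; have Ps' := inP s' PQs' Ss'.
have [q Qq S'q] := rooted_meets rQ Q0.
have [Uq|nUq] := boolP (q \in U).
  by exists q, s'; rewrite E' // S'q.
by exists s, q; rewrite E // Ss inE Qq orbT.
Qed.

Lemma conn_rooted A S x : conn A -> x \in A -> x \in S -> rooted S A.
Proof.
move=> /connP cA Ax Sx; apply/rootedP=> U sUA U0 US; apply: (cA U sUA U0 x) => //.
by apply/negP=> /US; rewrite Sx.
Qed.

Lemma set1_neq0 x : [set x] != set0.
Proof. by apply/set0Pn; exists x; rewrite inE. Qed.

Lemma rooted1 x : rooted [set x] [set x].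
Proof.
apply/rootedP=> U; rewrite subset1 => /predU1P[->|/eqP->]; last by rewrite eqxx.
by move=> _ /(_ x); rewrite inE eqxx => /(_ isT).
Qed.

Lemma conn1U x Q : x \notin Q -> conn (x |: Q) = rooted (nbr x) Q.
Proof.
move=> xQ; have [->|Q0] := eqVneq Q set0.
  by rewrite setU0 rooted0; apply/forall_inP=> s /set1P->; apply: rooted1.
by rewrite (conn_joined (joined_nbr xQ)) ?set1_neq0 // rooted1.
Qed.

Lemma rooted1U x Q : x \notin Q -> rooted [set x] (x |: Q) = rooted (nbr x) Q.
Proof. by move=> xQ; rewrite (rooted_joined (joined_nbr xQ)) ?set1_neq0 // rooted1. Qed.

Lemma conn_rooted1 A x : x \in A -> conn A = rooted [set x] A.
Proof. by move=> Ax; rewrite -(setD1K Ax) rooted1U ?conn1U ?setD11. Qed.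

Lemma conn_accessible A : conn A -> A != set0 -> exists2 v, v \in A & conn (A :\ v).
Proof.
move=> cA A0; have [x Ax] := set0Pn _ A0.
have [v Av rAv] : exists2 v, v \in A & rooted [set x] (A :\ v).
  by apply: rooted_accessible; rewrite -?conn_rooted1.
exists v => //; have [xAv|] := boolP (x \in A :\ v); first by rewrite (conn_rooted1 xAv).
rewrite !inE Ax andbT negbK => /eqP xv.
have [->|Av0] := eqVneq (A :\ v) set0.
  by apply/forall_inP=> s; rewrite inE.
by have [s] := rooted_meets rAv Av0; rewrite xv => sAv /set1P s_v; rewrite s_v setD11 in sAv.
Qed.

(** What the induction on positions needs from the graph. The first property
    deals with the removal of v from v + A when A stays connected; the second one
    with moves x that are legal in the game on A rooted at the neighbours of c,
    but not in the unrooted game. *)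
Definition decomposable : Prop :=
  (forall A v, conn A -> v \notin A -> (1 < #|nbr v :&: A|)%N ->
     exists P Q S', [/\ P :|: Q = A, Q != set0 & joined P (nbr v) Q S']) /\
  (forall A c x, conn A -> c \notin A -> x \in A ->
     rooted (nbr c) (A :\ x) -> ~~ conn (A :\ x) ->
     forall u, u \in A :\ x -> (c -- u) = (x -- u)).

End Joined.

(** * The rooted game *)

Section RootedGame.
Variables (R : realDomainType) (G : sgraph) (w : G -> R).
Implicit Types (A B P Q S U : {set G}) (u v x : G).

Definition rval S A : R := value w (rooted S) A.

Lemma rval_move S A v : v \in A -> rooted S (A :\ v) ->
  w v - rval S (A :\ v) <= rval S A.
Proof. exact: value_move. Qed.

Lemma rval_best S A : rooted S A -> A != set0 ->
  exists v, [/\ v \in A, rooted S (A :\ v) & rval S A = w v - rval S (A :\ v)].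
Proof. by move=> rA A0; apply: value_best; apply: rooted_accessible. Qed.

Lemma rval0 S : rval S set0 = 0.
Proof. exact: value0. Qed.

Lemma eq_rval S S' A :
  (forall u, u \in A -> (u \in S) = (u \in S')) -> rval S A = rval S' A.
Proof.
move=> eqS; apply: eq_value => B /subsetP sBA; apply: eq_rooted => u Bu.
by rewrite eqS ?sBA.
Qed.

Lemma oddD1 A v : v \in A -> odd #|A :\ v| = ~~ odd #|A|.
Proof. by move=> Av; rewrite (cardsD1 v A) Av /= negbK. Qed.

Lemma setU_D1l P Q v : v \notin Q -> (P :|: Q) :\ v = (P :\ v) :|: Q.
Proof.
move=> vQ; apply/setP=> z; rewrite !inE; case: eqP => //= ->.
by rewrite (negPf vQ).
Qed.

Lemma setU_D1r P Q v : v \notin P -> (P :|: Q) :\ v = P :|: (Q :\ v).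
Proof. by move=> vP; rewrite setUC setU_D1l // setUC. Qed.

Lemma odd_neq0 A : odd #|A| -> A != set0.
Proof. by apply: contraTneq => ->; rewrite cards0. Qed.

(** In the first bound the opponent of the player to move can always answer in the
    part just played in: a move in P leaves an even number of vertices there, so
    that an answer in P does not exhaust P, unless P is already empty and the game
    is over. The other two bounds follow by an optimal first move in Q,
    respectively in P, which leads to the situation of the first one. *)
Lemma rval_joined P Q S S' : joined P S Q S' ->
    P != set0 -> rooted S P -> rooted S' Q ->
  [/\ odd #|P| -> ~~ odd #|Q| -> rval S (P :|: Q) <= rval S P + rval S' Q,
      odd #|P| -> odd #|Q| -> rval S' Q - rval S P <= rval S (P :|: Q) &
      ~~ odd #|P| -> ~~ odd #|Q| -> rval S P - rval S' Q <= rval S (P :|: Q)].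
Proof.
have [n] := ubnP (#|P| + #|Q|); elim: n P Q => // n IHn P Q ltPQn spl P0 rP rQ.
have [dPQ dPS dQS E] := spl.
have notQ v : v \in P -> v \notin Q by move=> Pv; rewrite (disjointFr dPQ Pv).
have notP v : v \in Q -> v \notin P by move=> Qv; rewrite (disjointFl dPQ Qv).
have IHP v : v \in P -> rooted S (P :\ v) -> P :\ v != set0 ->
  [/\ odd #|P :\ v| -> ~~ odd #|Q| ->
        rval S ((P :|: Q) :\ v) <= rval S (P :\ v) + rval S' Q,
      odd #|P :\ v| -> odd #|Q| ->
        rval S' Q - rval S (P :\ v) <= rval S ((P :|: Q) :\ v) &
      ~~ odd #|P :\ v| -> ~~ odd #|Q| ->
        rval S (P :\ v) - rval S' Q <= rval S ((P :|: Q) :\ v)].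
  move=> Pv rPv Pv0; rewrite setU_D1l ?notQ //; apply: IHn => //.
    by move: ltPQn; rewrite (cardsD1 v P) Pv.
  by apply: joined_sub spl; rewrite ?subsetDl.
have IHQ v : v \in Q -> rooted S' (Q :\ v) ->
  [/\ odd #|P| -> ~~ odd #|Q :\ v| ->
        rval S ((P :|: Q) :\ v) <= rval S P + rval S' (Q :\ v),
      odd #|P| -> odd #|Q :\ v| ->
        rval S' (Q :\ v) - rval S P <= rval S ((P :|: Q) :\ v) &
      ~~ odd #|P| -> ~~ odd #|Q :\ v| ->
        rval S P - rval S' (Q :\ v) <= rval S ((P :|: Q) :\ v)].
  move=> Qv rQv; rewrite setU_D1r ?notP //; apply: IHn => //.
    by move: ltPQn; rewrite (cardsD1 v Q) Qv addnS.
  by apply: joined_sub spl; rewrite ?subsetDl.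
have legalP v : v \in P -> P :\ v != set0 ->
    rooted S ((P :|: Q) :\ v) = rooted S (P :\ v).
  move=> Pv Pv0; rewrite setU_D1l ?notQ // (rooted_joined _ Pv0 (S' := S')) ?rQ ?andbT //.
  by apply: joined_sub spl; rewrite ?subsetDl.
have legalQ v : v \in Q -> rooted S ((P :|: Q) :\ v) = rooted S' (Q :\ v).
  move=> Qv; rewrite setU_D1r ?notP // (rooted_joined _ P0 (S' := S')) ?rP //.
  by apply: joined_sub spl; rewrite ?subsetDl.
have rPQ : rooted S (P :|: Q) by rewrite (rooted_joined spl) ?rP.
split=> [oP eQ|oP oQ|eP eQ].
- have PQ0 : P :|: Q != set0 by rewrite setU_eq0 negb_and P0.
  have [v [PQv rv ->]] := rval_best rPQ PQ0; have := PQv; rewrite inE.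
  case: (boolP (v \in P)) => [Pv _|nPv /= Qv]; last first.
    rewrite legalQ // in rv; have [_ /(_ oP)] := IHQ v Qv rv.
    rewrite oddD1 // eQ => /(_ isT) le1 _; have := rval_move Qv rv; move: le1; clear; lra.
  (* Once P is exhausted, no root is left for Q, which must then be empty. *)
  have [Pv0|Pv0] := eqVneq (P :\ v) set0.
    suff Q0 : Q = set0.
      have := @rval_move S P v Pv; rewrite Q0 setU0 Pv0 !rval0 rooted0 => /(_ isT).
      by rewrite addr0.
    apply/eqP/negPn/negP=> Q0; rewrite setU_D1l ?notQ // Pv0 set0U in rv.
    by have [s Qs] := rooted_meets rv Q0; rewrite (disjointFr dQS Qs).
  rewrite legalP // in rv; have [_ _] := IHP v Pv rv Pv0.
  rewrite oddD1 // oP => /(_ isT eQ) le1; have := rval_move Pv rv; move: le1; clear; lra.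
- have [v [Qv rv ->]] := rval_best rQ (odd_neq0 oQ).
  have [/(_ oP) + _ _] := IHQ v Qv rv; rewrite oddD1 // oQ => /(_ isT) le1.
  have := @rval_move S (P :|: Q) v; rewrite inE Qv orbT legalQ // => /(_ isT rv).
  by move: le1; clear; lra.
have [v [Pv rv ->]] := rval_best rP P0.
have oPv : odd #|P :\ v| by rewrite oddD1.
have [/(_ oPv eQ) le1 _ _] := IHP v Pv rv (odd_neq0 oPv).
have := @rval_move S (P :|: Q) v; rewrite inE Pv /= legalP ?odd_neq0 //.
by move=> /(_ isT rv); move: le1; clear; lra.
Qed.

(** A single root is taken last, so its owner is determined by parity. *)
Lemma rval1U x Q : x \notin Q -> rooted (nbr x) Q ->
  rval [set x] (x |: Q) = rval (nbr x) Q + (if odd #|Q| then - w x else w x).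
Proof.
have [n] := ubnP #|Q|; elim: n Q => // n IHn Q ltQn xQ rQ.
have x1 : [set x] :\ x = set0 by apply/setP=> z; rewrite !inE; case: eqP.
have [->|Q0] := eqVneq Q set0.
  rewrite setU0 rval0 cards0 add0r.
  have [v [/set1P-> _ ->]] := rval_best (rooted1 x) (set1_neq0 x).
  by rewrite x1 rval0 subr0.
have D1 v : v \in Q -> (x |: Q) :\ v = x |: (Q :\ v).
  by move=> Qv; rewrite setU_D1r // inE; apply: contraNneq xQ => <-.
have IHQ v : v \in Q -> rooted (nbr x) (Q :\ v) -> rval [set x] ((x |: Q) :\ v) =
    rval (nbr x) (Q :\ v) - (if odd #|Q| then - w x else w x).
  move=> Qv rv; rewrite D1 // IHn ?oddD1 //.
  - by case: (odd #|Q|) => /=; rewrite ?opprK.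
  - by move: ltQn; rewrite (cardsD1 v Q) Qv.
  - by rewrite !inE (negPf xQ) andbF.
have legal v : v \in Q -> rooted [set x] ((x |: Q) :\ v) = rooted (nbr x) (Q :\ v).
  by move=> Qv; rewrite D1 // rooted1U // !inE (negPf xQ) andbF.
apply/le_anti/andP; split; last first.
  have [v [Qv rv ->]] := rval_best rQ Q0.
  have := @rval_move [set x] (x |: Q) v; rewrite inE Qv orbT legal // IHQ //.
  by move=> /(_ isT rv); clear; lra.
have [||v [xQv rv ->]] := @rval_best [set x] (x |: Q); first by rewrite rooted1U.
  by apply/set0Pn; exists x; rewrite setU11.
move: xQv; rewrite inE => /orP[/set1P v_x|Qv].
  rewrite v_x setU1K // in rv; have [s Qs /set1P s_x] := rooted_meets rv Q0.
  by rewrite -s_x Qs in xQ.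
rewrite legal // in rv; rewrite IHQ //; have := rval_move Qv rv; clear; lra.
Qed.

End RootedGame.

(** * The unrooted game against rooted games *)

Section ConnectedGame.
Variables (R : realDomainType) (G : sgraph) (w : G -> R).
Implicit Types (A B P Q S U : {set G}) (u v x c : G).
Local Notation rval := (rval w).

Definition cval A : R := value w (@conn G) A.

Lemma cval_move A v : v \in A -> conn (A :\ v) -> w v - cval (A :\ v) <= cval A.
Proof. exact: value_move. Qed.

Lemma cval_best A : conn A -> A != set0 ->
  exists v, [/\ v \in A, conn (A :\ v) & cval A = w v - cval (A :\ v)].
Proof. by move=> cA A0; apply: value_best; apply: conn_accessible. Qed.

Lemma cval0 : cval set0 = 0.
Proof. exact: value0. Qed.

Lemma connPn A : ~~ conn A -> exists U, [/\ U \subset A, U != set0,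
  exists2 z, z \in A & z \notin U &
  forall u v, u \in U -> v \in A -> v \notin U -> ~~ (u -- v)].
Proof.
case/forall_inPn=> s As /forallPn[U]; rewrite negb_imply.
case/andP=> /and3P[sUA U0 /pred0P Us] /exists_inPn noE; exists U; split=> //.
  by exists s => //; apply/negP=> sU; have /= := Us s; rewrite sU set11.
move=> u v Uu Av vU; apply: contra (noE u Uu) => uv.
by apply/exists_inP; exists v; rewrite // inE vU.
Qed.

Lemma conn_nbr A x : conn A -> x \in A -> A :\ x != set0 ->
  rooted (nbr x) (A :\ x) /\ exists2 u, u \in A :\ x & x -- u.
Proof.
move=> cA Ax Ax0; have rx : rooted (nbr x) (A :\ x).
  by rewrite -conn1U ?setD11 // setD1K.
by split=> //; have [u Au] := rooted_meets rx Ax0; rewrite inE; exists u.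
Qed.

Lemma rval_set1 S x : x \in S -> rval S [set x] = w x.
Proof.
move=> Sx; rewrite (@eq_rval _ _ _ _ [set x]) => [|u /set1P->]; last by rewrite Sx set11.
have := @rval1U _ _ w x set0; rewrite inE rooted0 setU0 => /(_ isT isT)->.
by rewrite rval0 cards0 add0r.
Qed.

(** Unrooting a game favours the player who does not make the last move: that is
    the second player here, and the first one in [even_bounds]. *)
Definition odd_bounds A : Prop :=
  (forall P Q S S', joined P S Q S' -> P :|: Q = A -> P != set0 -> Q != set0 ->
     cval A <= rval S P + rval S' Q) /\
  (forall c, c \notin A -> (exists2 u, u \in A & c -- u) ->
     cval A <= rval (nbr c) A).

Definition even_bounds A : Prop :=
  [/\ forall P Q S S', joined P S Q S' -> P :|: Q = A -> (1 < #|P|)%N ->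
        Q != set0 -> rval S P - rval S' Q <= cval A,
      forall x, x \in A -> 0 <= cval A + rval [set x] A &
      forall c, c \notin A -> (exists2 u, u \in A & c -- u) ->
        rval (nbr c) A <= cval A].

Lemma card_gt1_neq0 A : (1 < #|A|)%N -> A != set0.
Proof. by move=> A1; rewrite -card_gt0 ltnW. Qed.

Lemma even_gt1 A : ~~ odd #|A| -> A != set0 -> (1 < #|A|)%N.
Proof. by rewrite -card_gt0; case: #|A| => [|[|]]. Qed.

Lemma odd_cardU P Q S S' : joined P S Q S' -> odd #|P :|: Q| = odd #|P| (+) odd #|Q|.
Proof. by case=> dPQ _ _ _; rewrite cardsU disjoint_setI0 // cards0 subn0 oddD. Qed.

(** The bound of [rval_joined] on D(A; S) is the opposite of D(P; S) - D(Q; S') if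
    |P| and |Q| are odd, and of D(Q; S') - D(P; S) if they are even; in the second
    case |Q| > 1 by parity, so that the two sides can be exchanged. *)
Lemma cval_rval_joined A P Q S S' : conn A -> ~~ odd #|A| ->
    (forall P Q S S', joined P S Q S' -> P :|: Q = A -> (1 < #|P|)%N ->
        Q != set0 -> rval S P - rval S' Q <= cval A) ->
    joined P S Q S' -> P :|: Q = A -> (1 < #|P|)%N -> Q != set0 ->
  0 <= cval A + rval S A.
Proof.
move=> + + E1 jPQ defA P1 Q0; rewrite -defA (odd_cardU jPQ) => cA.
have P0 := card_gt1_neq0 P1.
move: cA; rewrite (conn_joined jPQ) // => /andP[rP rQ].
have [_ LBoo LBee] := rval_joined w jPQ P0 rP rQ.
have := E1 _ _ _ _ jPQ defA P1 Q0; rewrite -defA.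
case oP: (odd #|P|) LBoo LBee; case oQ: (odd #|Q|) => //= LBoo LBee le1 _.
  by have := LBoo isT isT; move: le1; clear; lra.
have := E1 _ _ _ _ (joined_sym jPQ) _ _ P0; rewrite setUC even_gt1 ?oQ // -defA.
by have := LBee isT isT; clear; move=> + /(_ erefl isT); lra.
Qed.

Hypothesis decG : decomposable G.

(** The first player opens with a best move of the rooted game in question; if the
    odd set that is left is connected, its bounds give those at A. *)
Lemma even_step A : conn A -> ~~ odd #|A| ->
  (forall v, v \in A -> conn (A :\ v) -> odd_bounds (A :\ v)) -> even_bounds A.
Proof.
move=> cA eA IH.
have oD v : v \in A -> odd #|A :\ v| by move/oddD1->.
have E1 P Q S S' : joined P S Q S' -> P :|: Q = A -> (1 < #|P|)%N -> Q != set0 ->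
    rval S P - rval S' Q <= cval A.
  move=> jPQ defA P1 Q0; have P0 := card_gt1_neq0 P1; have [dPQ _ _ _] := jPQ.
  have /andP[rP rQ] : rooted S P && rooted S' Q by rewrite -(conn_joined jPQ) ?defA.
  have [v [Pv rv ->]] := rval_best w rP P0.
  have Av : v \in A by rewrite -defA inE Pv.
  have Pv0 : P :\ v != set0 by rewrite -card_gt0; move: P1; rewrite (cardsD1 v P) Pv.
  have defAv : (P :\ v) :|: Q = A :\ v by rewrite -defA setU_D1l // (disjointFr dPQ).
  have jv : joined (P :\ v) S Q S' by apply: joined_sub jPQ; rewrite ?subsetDl.
  have cv : conn (A :\ v) by rewrite -defAv (conn_joined jv) // rv.
  have := (IH v Av cv).1 _ _ _ _ jv defAv Pv0 Q0; have := cval_move Av cv.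
  by clear; lra.
have E2 x : x \in A -> 0 <= cval A + rval [set x] A.
  move=> Ax; have Ax0 := odd_neq0 (oD x Ax); have [rx ex] := conn_nbr cA Ax Ax0.
  have [cAx|/connPn[U [sU U0 [z Az zU] noE]]] := boolP (conn (A :\ x)).
    have := (IH x Ax cAx).2 x; rewrite setD11 => /(_ isT ex).
    have := rval1U w (negbT (setD11 x A)) rx; rewrite setD1K // oD // => ->.
    by have := cval_move Ax cAx; clear; lra.
  (* Here x is a cut vertex: a union U of components of A - x is attached to the
     rest of A at x only, and that rest is larger than {x}. *)
  have xU : x \notin U by apply/negP=> /(subsetP sU); rewrite setD11.
  have sUA : U \subset A by apply: subset_trans sU _; apply: subsetDl.
  have jU : joined (A :\: U) [set x] U (nbr x :&: U).
    split=> [|||a b].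
    - by rewrite disjoints_subset; apply/subsetP=> u; rewrite !inE => /andP[].
    - rewrite disjoints_subset; apply/subsetP=> u.
      by rewrite !inE => /andP[/negPf->]; rewrite andbF.
    - by rewrite disjoint_sym disjoints1.
    move=> /setDP[Aa aU] Ub; rewrite !inE Ub andbT.
    have [->//|ax] := eqVneq a x.
    by apply/negbTE; rewrite adj_sym noE // inE inE ax.
  apply: (cval_rval_joined cA eA E1 jU) => //.
    by rewrite setUC setDE setUIr setUCr setIT; apply/setUidPr.
  have xz : x != z by apply: contraTneq Az => <-; rewrite setD11.
  rewrite (cardsD1 x) (cardsD1 z) !inE xU Ax zU eq_sym xz /= .
  by case/setD1P: Az => _ ->.
split=> // c cA' [u Au cu].
have rc : rooted (nbr c) A by apply: (conn_rooted cA Au); rewrite inE.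
have A0 : A != set0 by apply/set0Pn; exists u.
have [v [Av rv ->]] := rval_best w rc A0.
have Av0 := odd_neq0 (oD v Av).
have [cv|ncv] := boolP (conn (A :\ v)).
  have [s sA cs] := rooted_meets rv Av0; rewrite inE in cs.
  have := (IH v Av cv).2 c; rewrite inE negb_and cA' orbT => /(_ isT).
  have /[swap]/[apply] : exists2 u, u \in A :\ v & c -- u by exists s.
  by have := cval_move Av cv; clear; lra.
(* The best rooted move v disconnects A. It leaves a position with the roots
   N(v) in place of N(c), so that its worth is minus the value of the game
   rooted at v alone. *)
have eqN := decG.2 A c v cA cA' Av rv ncv.
have eqNs t : t \in A :\ v -> (t \in nbr c) = (t \in nbr v).
  by move=> At; rewrite !inE eqN.
rewrite (eq_rval w eqNs); have [rv' _] := conn_nbr cA Av Av0.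
have := rval1U w (negbT (setD11 v A)) rv'; rewrite setD1K // oD // => eqv.
by have := E2 v Av; rewrite eqv; clear; lra.
Qed.

(** Used when the removal of v exhausts one side of a 1-join, or removes the last
    root. A single neighbour of v is a single root of A; otherwise the neighbours
    of v are an attachment set of a 1-join. *)
Lemma cval_rval_nbr A v : conn A -> ~~ odd #|A| -> v \notin A ->
    (exists2 u, u \in A & v -- u) -> even_bounds A ->
  0 <= cval A + rval (nbr v) A.
Proof.
move=> cA eA vA [u Au vu] [E1 E2 _].
have uN : u \in nbr v :&: A by rewrite !inE vu.
have [N1|N1] := leqP #|nbr v :&: A| 1.
  have defN : nbr v :&: A = [set u].
    by apply/esym/eqP; rewrite eqEcard sub1set uN cards1.
  rewrite (@eq_rval _ _ _ _ [set u]) ?E2 // => t At.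
  by rewrite -defN [RHS]inE At andbT.
have [P [Q [S' [defA Q0 jPQ]]]] := decG.1 A v cA vA N1.
apply: (cval_rval_joined cA eA E1 jPQ defA) => //.
apply: leq_trans N1 (subset_leq_card _); apply/subsetP=> t /setIP[vt].
have [_ _ dQN _] := jPQ.
by rewrite -defA inE => /orP[//|Qt]; rewrite (disjointFr dQN Qt) in vt.
Qed.

(** Whatever the first player claims, the even set that is left is connected, and
    its bounds give those at A; the case to watch is a move which exhausts a side
    of the 1-join or takes the last root. *)
Lemma odd_step A : conn A -> odd #|A| ->
  (forall v, v \in A -> conn (A :\ v) -> even_bounds (A :\ v)) -> odd_bounds A.
Proof.
move=> cA oA IH; have A0 := odd_neq0 oA.
have eD v : v \in A -> ~~ odd #|A :\ v| by move=> Av; rewrite oddD1 ?oA.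
have [v [Av cv eqA]] := cval_best cA A0; rewrite /odd_bounds eqA {eqA}.
have [E1 E2 E3] := IH v Av cv.
split=> [P Q S S'|c cA' [u Au cu]]; last first.
  have vD := negbT (setD11 v A).
  have [t /andP[/= At ct]|nt] := pickP [pred t | (t \in A :\ v) && (c -- t)].
    have cD : c \notin A :\ v by rewrite inE negb_and cA' orbT.
    have rc : rooted (nbr c) (A :\ v) by apply: (conn_rooted cv At); rewrite inE.
    have := rval_move w Av rc.
    have := E3 c cD (ex_intro2 _ _ t At ct); clear; lra.
  have eqN t : t \in A -> (t \in nbr c) = (t \in [set v]).
    move=> At; rewrite !inE; have [->|tv] := eqVneq t v.
      have [->//|uv] := eqVneq v u.
      by have := nt u; rewrite /= !inE eq_sym uv Au cu.
    by have := nt t; rewrite /= !inE tv At.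
  rewrite (eq_rval w eqN); have [Av0|Av0] := eqVneq (A :\ v) set0.
    by rewrite Av0 cval0 -(setD1K Av) Av0 setU0 rval_set1 ?set11 // subr0.
  have [rv ev] := conn_nbr cA Av Av0.
  have := rval1U w vD rv; rewrite setD1K // (negPf (eD v Av)) => ->.
  by have := cval_rval_nbr cv (eD v Av) vD ev (IH v Av cv); clear; lra.
wlog oP : P Q S S' / odd #|P|.
  move=> IW jPQ defA P0 Q0; have [oP|eP] := boolP (odd #|P|); first exact: (IW P Q).
  have oQ : odd #|Q| by move: oA; rewrite -defA (odd_cardU jPQ) (negPf eP).
  rewrite [leRHS]addrC; apply: (IW Q P S' S oQ (joined_sym jPQ)) => //.
  by rewrite setUC.
move=> jPQ defA P0 Q0; have [dPQ dPS dQS E] := jPQ.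
have eQ : ~~ odd #|Q| by move: oA; rewrite -defA (odd_cardU jPQ) oP.
have /andP[rP rQ] : rooted S P && rooted S' Q by rewrite -(conn_joined jPQ) ?defA.
have [Pv|nPv] := boolP (v \in P).
  have nQv : v \notin Q by rewrite (disjointFr dPQ).
  have defAv : (P :\ v) :|: Q = A :\ v by rewrite -defA setU_D1l.
  have [Pv0|Pv0] := eqVneq (P :\ v) set0.
    have Pset1 : P = [set v] by rewrite -(setD1K Pv) Pv0 setU0.
    have Sv : v \in S by have [s] := rooted_meets rP P0; rewrite Pset1 => /set1P->.
    move: defAv; rewrite Pv0 set0U => defQ; rewrite -defQ in cv.
    have [s Qs S's] := rooted_meets rQ Q0.
    have ev : exists2 u, u \in Q & v -- u by exists s; rewrite // E // Sv.
    have bQ : even_bounds Q by rewrite defQ; apply: IH; rewrite -?defQ.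
    have := cval_rval_nbr cv eQ nQv ev bQ.
    rewrite -defQ Pset1 rval_set1 // (@eq_rval _ _ w (nbr v) S').
      by clear; lra.
    by move=> t Qt; rewrite inE E // Sv.
  have jv : joined (P :\ v) S Q S' by apply: joined_sub jPQ; rewrite ?subsetDl.
  have P1 : (1 < #|P :\ v|)%N by rewrite even_gt1 // oddD1 ?oP.
  have := cv; rewrite -defAv (conn_joined jv) // => /andP[rv _].
  have := E1 _ _ _ _ jv defAv P1 Q0; rewrite -defAv.
  by have := rval_move w Pv rv; clear; lra.
have Qv : v \in Q by move: Av; rewrite -defA inE (negPf nPv).
have defAv : (Q :\ v) :|: P = A :\ v by rewrite -defA setUC -setU_D1r // setUC.
have oQ : odd #|Q :\ v| by rewrite oddD1.
have Qv0 := odd_neq0 oQ.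
have jv : joined (Q :\ v) S' P S.
  by apply/joined_sym; apply: joined_sub jPQ; rewrite ?subsetDl.
have := cv; rewrite -defAv (conn_joined jv) // => /andP[rv _].
have le1 : rval S' (Q :\ v) - rval S P <= cval (A :\ v); last first.
  by move: le1; rewrite -defAv; have := rval_move w Qv rv; clear; lra.
have [Q1|Q1] := ltnP 1 #|Q :\ v|; first exact: E1 jv defAv Q1 P0.
(* If a single vertex q of Q is left, the bound for 1-joins with a larger first
   side does not apply, but the one for the game rooted at q says the same. *)
have [q defQ] : exists q, Q :\ v = [set q].
  by apply/cards1P; rewrite eqn_leq Q1 card_gt0.
have S'q : q \in S' by have [s] := rooted_meets rv Qv0; rewrite defQ => /set1P->.
have Qq : q \in Q by have /setD1P[] : q \in Q :\ v by rewrite defQ set11.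
have Pq : q \notin P by rewrite (disjointFl dPQ).
have eqS t : t \in P -> (t \in nbr q) = (t \in S).
  by move=> Pt; rewrite inE adj_sym E // S'q andbT.
have := E2 q; rewrite -defAv defQ inE set11 => /(_ isT).
rewrite rval1U //; last by rewrite (eq_rooted eqS).
by rewrite oP (eq_rval w eqS) rval_set1 //; clear; lra.
Qed.

Lemma game_bounds A : conn A -> if odd #|A| then odd_bounds A else even_bounds A.
Proof.
have [n] := ubnP #|A|; elim: n A => // n IHn A ltAn cA.
have IH v : v \in A -> conn (A :\ v) ->
    if odd #|A| then even_bounds (A :\ v) else odd_bounds (A :\ v).
  move=> Av cv; have := IHn (A :\ v); rewrite oddD1 // if_neg; apply=> //.
  by move: ltAn; rewrite (cardsD1 v A) Av.
by case: ifPn IH => oA IH; [apply: odd_step | apply: even_step].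
Qed.

(** The bounds for the 1-join of {x} and its complement, read in both orders, are
    opposite. When A has only two vertices, the second order is replaced by the
    bound for the other vertex. *)
Lemma cval_ge0 A : conn A -> ~~ odd #|A| -> 0 <= cval A.
Proof.
move=> cA eA; have [->|A0] := eqVneq A set0; first by rewrite cval0.
have := game_bounds cA; rewrite (negPf eA) => -[E1 E2 _].
have bnd x : x \in A -> w x - rval (nbr x) (A :\ x) <= cval A.
  move=> Ax; have oAx : odd #|A :\ x| by rewrite oddD1.
  have [rx _] := conn_nbr cA Ax (odd_neq0 oAx).
  have := rval1U w (negbT (setD11 x A)) rx; rewrite setD1K // oAx.
  by have := E2 x Ax => + eqx; rewrite eqx; clear; lra.
have [x Ax] := set0Pn _ A0.
have oAx : odd #|A :\ x| by rewrite oddD1.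
have jx := joined_sym (joined_nbr (negbT (setD11 x A))).
have [|A1] := ltnP 1 #|A :\ x|.
  move/(E1 _ _ _ _ jx); rewrite setUC setD1K // set1_neq0 => /(_ erefl isT).
  by rewrite rval_set1 ?set11 //; have := bnd x Ax; clear; lra.
have [y defy] : exists y, A :\ x = [set y].
  by apply/cards1P; rewrite eqn_leq A1 card_gt0 odd_neq0.
have Axy : y \in A :\ x by rewrite defy set11.
have [yx Ay] := setD1P Axy.
have defx : A :\ y = [set x].
  apply/eqP; rewrite eqEsubset sub1set !inE eq_sym yx Ax !andbT.
  apply/subsetP=> z /setD1P[zy Az]; rewrite inE; apply: contraNT zy => zx.
  by rewrite -in_set1 -defy !inE zx.
have [rx [u]] := conn_nbr cA Ax (odd_neq0 oAx).
rewrite defy => /set1P-> xy.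
have := bnd x Ax; have := bnd y Ay; rewrite defx defy !rval_set1 ?inE // 1?adj_sym //.
by clear; lra.
Qed.

End ConnectedGame.

(** * From the value to a strategy *)

Section Strategy.
Variables (R : realType) (G : sgraph) (w : G -> R).
Implicit Types (p q : seq G) (v : G).
Local Notation cval := (cval w).

Definition best_move : strategy G := fun p =>
  [pick v | claimable (remaining p) v &
            cval (remaining p) == w v - cval (remaining p :\ v)].

Lemma remaining_nil : remaining [::] = [set: G].
Proof. by apply/setP=> v; rewrite !inE. Qed.

Lemma remaining_rcons p v : remaining (rcons p v) = remaining p :\ v.
Proof. by apply/setP=> u; rewrite !inE mem_rcons inE negb_or. Qed.

Lemma play_rcons p v : play (rcons p v) -> play p /\ claimable (remaining p) v.
Proof.
move=> pl; split=> [q u pq|]; apply: pl; last exact: prefix_refl.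
by apply: prefix_trans pq _; apply: prefix_rcons.
Qed.

Lemma alice_follows_rcons (s : strategy G) p v : alice_follows s (rcons p v) ->
  alice_follows s p /\ (~~ odd (size p) -> s p = Some v).
Proof.
move=> fol; split=> [q u pq|]; apply: fol; last exact: prefix_refl.
by apply: prefix_trans pq _; apply: prefix_rcons.
Qed.

Lemma conn_remaining p : connected G -> play p -> conn (remaining p).
Proof.
move=> cG; case/lastP: p => [_|p v /play_rcons[_ /andP[_]]].
  by rewrite remaining_nil -connected_inE.
by rewrite remaining_rcons connected_inE.
Qed.

Lemma alice_gain_rcons p v : v \notin p ->
  alice_gain w (rcons p v) = alice_gain w p + (if odd (size p) then 0 else w v).
Proof.
move=> pv; rewrite /alice_gain -cats1 big_cat big_seq_cond /=; congr (_ + _).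
  rewrite [RHS]big_seq_cond; apply: eq_bigl => u.
  by case: (boolP (u \in p)) => //= pu; rewrite index_cat pu.
rewrite big_cons big_nil index_cat (negPf pv) /= eqxx addn0.
by case: odd; rewrite /= ?addr0.
Qed.

(** Along a play the lead of Alice plus the value of the rest, seen from her side,
    does not decrease from its initial value: it is constant at her moves, and no move of Bob does
    better than the value. *)
Lemma best_move_balance p : connected G -> play p -> alice_follows best_move p ->
  cval [set: G] <= 2 * alice_gain w p - \sum_(v <- p) w v +
    (if odd (size p) then - cval (remaining p) else cval (remaining p)).
Proof.
move=> cG; elim/last_ind: p => [_ _|p v IHp].
  by rewrite remaining_nil /alice_gain !big_nil /= mulr0 subr0 add0r.
case/play_rcons=> pl /andP[pv cpv] /alice_follows_rcons[fol sp].
have := IHp pl fol; have vNp : v \notin p by rewrite inE in pv.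
rewrite alice_gain_rcons // size_rcons remaining_rcons -cats1 big_cat big_seq1 /=.
have := cval_move w pv; rewrite -connected_inE => /(_ cpv).
case: (odd (size p)) sp => /= [_|/(_ isT)]; first by clear; lra.
rewrite /best_move; case: pickP => // u /andP[_ /eqP->] [->].
by clear; lra.
Qed.

Lemma alice_wins_cval_ge0 : connected G -> 0 <= cval [set: G] -> alice_wins w.
Proof.
move=> cG ge0; exists best_move => [p pl fol ep rp0|p pl fol rp0].
  have cp := conn_remaining cG pl.
  have [v [pv cv eqv]] := cval_best w cp rp0.
  rewrite /best_move; case: pickP => [u /andP[cu _]|/(_ v)]; first by exists u.
  by rewrite /claimable pv connected_inE cv eqv eqxx.
have := best_move_balance cG pl fol; rewrite rp0 cval0 oppr0 if_same addr0.
suff -> : \sum_(v <- p) w v = \sum_v w v by lra.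
have Up : uniq p.
  elim/last_ind: p pl {fol rp0} => // p v IHp /play_rcons[pl /andP[pv _]].
  by rewrite rcons_uniq IHp // andbT; rewrite inE in pv.
rewrite big_uniq //; apply: eq_bigl => v.
by apply/negPn; have := in_set0 v; rewrite -rp0 inE => ->.
Qed.

End Strategy.

(** * B(T)-trees are decomposable *)

(** For adjacent x and y, the edge xy is a bridge and W is a side of its cut. *)
Definition bridge (F : sgraph) (x y : F) : Prop :=
  exists W : {set F}, [/\ x \in W, y \notin W &
    forall a b, a \in W -> b \notin W -> a -- b -> a = x /\ b = y].

(** The structure of a B(T)-tree G, without dependent types: [bk] gives the tree
    of G containing a vertex, [core] recognizes the vertex at which this tree is
    attached to the blow-up, and [cl] is the class of that vertex, a vertex of
    T. *)
Record layout (G T : sgraph) (B : eqType) (bk : G -> B) (core : pred G)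
    (cl : G -> T) : Prop := Layout {
  core_inj : forall u v, core u -> core v -> bk u = bk v -> u = v;
  block_class : forall u v, bk u = bk v -> cl u = cl v;
  adj_block : forall u v, u -- v ->
    bk u = bk v \/ [/\ core u, core v & cl u -- cl v];
  core_adj : forall u v, core u -> core v -> cl u -- cl v -> u -- v;
  block_bridge : forall u v, u -- v -> bk u = bk v -> bridge u v;
  class_bridge : forall i j : T, i -- j -> bridge i j }.

Section LayoutDecomposable.
Variables (G T : sgraph) (B : eqType) (bk : G -> B) (core : pred G) (cl : G -> T).
Hypothesis lay : layout bk core cl.
Implicit Types (A P Q S U : {set G}) (u v x y c : G).

(** An edge from c to y1 inside a tree would be a bridge, separating A, which
    avoids c, from all other neighbours of c. *)
Lemma outer_nbr_core A c y1 y2 : conn A -> c \notin A -> y1 \in A -> y2 \in A ->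
    y1 != y2 -> c -- y1 -> c -- y2 -> [/\ core c, core y1 & cl c -- cl y1].
Proof.
move=> cA cA' Ay1 Ay2 y12 cy1 cy2.
case: (adj_block lay cy1) => // /(block_bridge lay cy1)[W [Wc y1W WE]].
case: (boolP (y2 \in W)) => y2W; last first.
  by have [_ y21] := WE c y2 Wc y2W cy2; rewrite y21 eqxx in y12.
have [||||a [b []]] := connP _ cA (A :&: W) _ _ y1 => //.
- exact: subsetIl.
- by apply/set0Pn; exists y2; rewrite inE Ay2.
- by rewrite inE negb_and y1W orbT.
rewrite !inE => /andP[Aa Wa] Ab; rewrite Ab /= => bW ab.
by have [ac _] := WE a b Wa bW ab; rewrite -ac Aa in cA'.
Qed.

(** Without core vertices of class i, a connected set lies on one side of every
    cut given by an edge of T at i. *)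
Lemma nbr_one_class A (i : T) y : conn A -> y \in A -> i -- cl y ->
    (forall a, a \in A -> core a -> cl a != i) ->
  forall u, u \in A -> i -- cl u -> cl u = cl y.
Proof.
move=> cA Ay iy noi u Au iu.
have [W [Wi yW WE]] := class_bridge lay iy.
have [Wu|uW] := boolP (cl u \in W); last by have [] := WE _ _ Wi uW iu.
have [||||a [b []]] := connP _ cA [set a in A | cl a \in W] _ _ y => //.
- by apply/subsetP=> a; rewrite inE => /andP[].
- by apply/set0Pn; exists u; rewrite inE Au.
- by rewrite inE negb_and yW orbT.
rewrite !inE => /andP[Aa Wa] Ab; rewrite Ab /= => bW ab.
case: (adj_block lay ab) => [/(block_class lay) eq_cl|[core_a _ clab]].
  by rewrite -eq_cl Wa in bW.
by have [ai _] := WE _ _ Wa bW clab; have := noi a Aa core_a; rewrite ai eqxx.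
Qed.

(** A path from y1 to y2 leaves the tree attached at y1 through y1 itself. *)
Lemma exit_block A y1 y2 : conn A -> y1 \in A -> y2 \in A -> core y1 -> core y2 ->
  y1 != y2 -> exists b, [/\ b \in A, core b & cl y1 -- cl b].
Proof.
move=> cA Ay1 Ay2 c1 c2 y12.
have [||||a [b []]] := connP _ cA [set a in A | bk a == bk y1] _ _ y2 => //.
- by apply/subsetP=> a; rewrite inE => /andP[].
- by apply/set0Pn; exists y1; rewrite inE Ay1 eqxx.
- rewrite inE negb_and Ay2 /=; apply: contra y12 => /eqP eqb.
  by rewrite (core_inj lay c2 c1 eqb).
rewrite !inE => /andP[Aa /eqP eqa] Ab; rewrite Ab /= => bb ab.
case: (adj_block lay ab) => [eqab|[core_a core_b clab]].
  by rewrite -eqab eqa eqxx in bb.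
by exists b; split; rewrite // -(block_class lay eqa).
Qed.

(** If A has a core vertex v' of the same class as v, then v' is adjacent to the
    neighbours of v in A, and these are the attachment set opposite to the tree
    at v'. Otherwise the neighbours of v form the trace on A of a single class
    j, and a path between two of them visits a class k adjacent to j: the edge jk
    of T then gives the 1-join. *)
Lemma layout_nbr_joined A v : conn A -> v \notin A -> (1 < #|nbr v :&: A|)%N ->
  exists P Q S', [/\ P :|: Q = A, Q != set0 & joined P (nbr v) Q S'].
Proof.
move=> cA vA /card_gt1P[y1 [y2 [/setIP[+ Ay1] /setIP[+ Ay2] y12]]].
rewrite !inE => vy1 vy2.
have nbr_core u : u \in A -> v -- u -> [/\ core v, core u & cl v -- cl u].
  move=> Au vu; have [uy1|uy1] := eqVneq u y1.
    by rewrite uy1; apply: (outer_nbr_core cA vA Ay1 Ay2).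
  exact: (outer_nbr_core cA vA Au Ay1).
have [core_v core_1 cl1] := nbr_core y1 Ay1 vy1.
have [_ core_2 cl2] := nbr_core y2 Ay2 vy2.
have cut_split (D : pred G) S' q : q \in A -> ~~ D q ->
    (forall u, u \in A -> v -- u -> D u) ->
    (forall u, u \in A -> D u -> u \notin S') ->
    (forall a b, a \in A -> b \in A -> D a -> ~~ D b ->
       (a -- b) = (v -- a) && (b \in S')) ->
  exists P Q S', [/\ P :|: Q = A, Q != set0 & joined P (nbr v) Q S'].
  move=> Aq Dq DN DS' DE.
  exists [set a in A | D a], [set a in A | ~~ D a], S'; split.
  - by apply/setP=> a; rewrite !inE -andb_orr orbN andbT.
  - by apply/set0Pn; exists q; rewrite inE Aq.
  split.
  - by rewrite disjoints_subset; apply/subsetP=> a; rewrite !inE => /andP[-> ->].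
  - by rewrite disjoints_subset; apply/subsetP=> a; rewrite !inE => /andP[/DS' h /h].
  - rewrite disjoints_subset; apply/subsetP=> a; rewrite !inE => /andP[Aa].
    by apply: contra => /(DN a Aa).
  by move=> a b; rewrite !inE => /andP[Aa Da] /andP[Ab Db]; rewrite DE.
have [v' /and3P[Av' core_v' /eqP cl_v']|no_twin] :=
    pickP [pred v' | [&& v' \in A, core v' & cl v' == cl v]].
  apply: (cut_split [pred a | bk a != bk v'] [set v'] v') => //=.
  - by rewrite eqxx.
  - move=> u Au /(nbr_core u Au)[_ core_u clu].
    apply/negP=> /eqP/(block_class lay) eq_cl.
    by rewrite eq_cl cl_v' adj_irr in clu.
  - by move=> u Au; rewrite inE; apply: contra => /eqP->.
  move=> a b Aa Ab av' /negPn/eqP bv'; rewrite inE; apply/idP/andP.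
    move=> ab; case: (adj_block lay ab) => [eqab|[core_a core_b clab]].
      by rewrite eqab bv' eqxx in av'.
    have eqb := core_inj lay core_b core_v' bv'.
    split; last exact/eqP.
    by apply: (core_adj lay) => //; rewrite adj_sym -cl_v' -eqb.
  case=> va /eqP->; have [_ core_a cla] := nbr_core a Aa va.
  by apply: (core_adj lay) => //; rewrite adj_sym cl_v'.
have noi a : a \in A -> core a -> cl a != cl v.
  by move=> Aa ca; have /= := no_twin a; rewrite Aa ca /= => ->.
have [b [Ab core_b cl1b]] := exit_block cA Ay1 Ay2 core_1 core_2 y12.
have [W [W1 bW WE]] := class_bridge lay cl1b.
apply: (cut_split [pred a | cl a \in W] [set u | core u & cl u == cl b] b) => //=.
- move=> u Au vu; have [_ _ clu] := nbr_core u Au vu.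
  by rewrite (nbr_one_class cA Ay1 cl1 noi Au clu).
- move=> u _ Wu; rewrite inE negb_and orbC.
  by apply/orP; left; apply: contraNneq bW => <-.
move=> a a' Aa Aa' Wa a'W; rewrite inE; apply/idP/and3P.
  move=> aa'; case: (adj_block lay aa') => [/(block_class lay) e|[ca ca' claa']].
    by rewrite -e Wa in a'W.
  have [ea ea'] := WE _ _ Wa a'W claa'; split=> //; last exact/eqP.
  by apply: (core_adj lay) => //; rewrite ea.
case=> va ca' /eqP cla'; have [_ ca cla] := nbr_core a Aa va.
by apply: (core_adj lay) => //; rewrite (nbr_one_class cA Ay1 cl1 noi Aa cla) cla'.
Qed.

(** Two neighbours u1 and u2 of c are separated in A - x, so they have no common
    neighbour there. If x is a core vertex of the class of c, the claim is
    clear, up to neighbours of x in its own tree: such a neighbour would lie in a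
    component without neighbour of c. Otherwise A has no core vertex of the class
    of c, all neighbours of c in A form the trace of a single class j, and a
    path from u1 to u2 visits a class adjacent to j; its core vertices in A are
    adjacent to both u1 and u2, so that x is the only one. *)
Lemma layout_cut_twin A c x : conn A -> c \notin A -> x \in A ->
    rooted (nbr c) (A :\ x) -> ~~ conn (A :\ x) ->
  forall u, u \in A :\ x -> (c -- u) = (x -- u).
Proof.
move=> cA cA' Ax rc /connPn[U [sU U0 [z Az zU] noE]].
have [u1 Uu1 cu1] : exists2 u, u \in U & c -- u.
  have [u /andP[/= Uu cu]|nU] := pickP [pred u | (u \in U) && (c -- u)].
    by exists u.
  have [u Uu|u [v [Uu Av vU uv]]] := rootedP _ _ rc U sU U0.
    by have /= := nU u; rewrite Uu inE /= => ->.
  by have := noE u v Uu Av vU; rewrite uv.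
have sUA u : u \in U -> u \in A :\ x by apply/subsetP.
have noE' u v : u \in U -> v \in A :\ x -> v \notin U -> v -- u -> False.
  by move=> Uu Av vU; rewrite adj_sym; apply/negP; apply: noE.
have [u2 [A2 u2U cu2]] : exists u, [/\ u \in A :\ x, u \notin U & c -- u].
  have [u /and3P[/= Au uU cu]|nU] :=
      pickP [pred u | [&& u \in A :\ x, u \notin U & c -- u]]; first by exists u.
  have [||u|u [v [/setDP[Au uU] Av]]] := rootedP _ _ rc ((A :\ x) :\: U).
  - exact: subsetDl.
  - by apply/set0Pn; exists z; rewrite inE zU.
  - by rewrite inE [u \in nbr c]inE => /andP[uU Au]; have /= := nU u; rewrite Au uU /= => ->.
  by rewrite inE Av andbT negbK => Uv /(noE' v u Uv Au uU).
have inA u : u \in A :\ x -> u \in A by case/setD1P.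
have u12 : u1 != u2 by apply: contraNneq u2U => <-.
have A1 := sUA _ Uu1.
have nbr_core u : u \in A -> c -- u -> [/\ core c, core u & cl c -- cl u].
  move=> Au cu; have [uu1|uu1] := eqVneq u u1.
    by rewrite uu1; apply: (outer_nbr_core cA cA' _ (inA _ A2)); rewrite ?inA.
  by apply: (outer_nbr_core cA cA' Au (inA _ A1)).
have [core_c core_1 cl1] := nbr_core u1 (inA _ A1) cu1.
have [_ core_2 cl2] := nbr_core u2 (inA _ A2) cu2.
have no_common a : a \in A :\ x -> a -- u1 -> a -- u2 -> False.
  move=> Aa a1 a2; have [Ua|Ua] := boolP (a \in U).
    by apply: (noE' a u2) => //; rewrite adj_sym.
  exact: (noE' u1 a).
suff [core_x Ncx Nxc] : [/\ core x, forall u, u \in A :\ x -> c -- u -> x -- u &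
    forall u, u \in A :\ x -> x -- u -> core u -> cl x -- cl u -> c -- u].
  move=> u Au; apply/idP/idP => [|xu]; first exact: Ncx.
  case: (adj_block lay xu) => [bxu|[_ core_u clxu]]; last exact: Nxc.
  rewrite adj_sym in xu.
  have [W [Wu xW WE]] := block_bridge lay xu (esym bxu).
  have [||t|a [b []]] := rootedP _ _ rc ((A :\ x) :&: W).
  - exact: subsetIl.
  - by apply/set0Pn; exists u; rewrite !inE in Au *; rewrite Au.
  - rewrite inE [t \in nbr c]inE => /andP[At Wt]; apply/negP=> ct.
    have [tu _] := WE t x Wt xW (etrans (adj_sym _ _) (Ncx t At ct)).
    have [_ core_t _] := nbr_core t (inA _ At) ct.
    have tx : t = x by apply: (core_inj lay) => //; rewrite tu.
    by rewrite tx setD11 in At.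
  rewrite inE => /andP[Aa Wa] Ab; rewrite inE Ab /= => bW ab.
  by have [_ bx] := WE a b Wa bW ab; rewrite bx setD11 in Ab.
have Nc_cl a : core a -> cl a = cl c -> forall u, u \in A -> c -- u -> a -- u.
  move=> ca cla u Au cu; have [_ core_u clu] := nbr_core u Au cu.
  by apply: (core_adj lay) => //; rewrite cla.
have [/andP[core_x /eqP clx]|nx] := boolP (core x && (cl x == cl c)).
  split=> // [u Au cu|u Au _ core_u clu]; first by apply: Nc_cl; rewrite ?inA.
  by apply: (core_adj lay) => //; rewrite -clx.
have noi a : a \in A -> core a -> cl a != cl c.
  move=> Aa ca; have [ax|ax] := eqVneq a x.
    by move: nx; rewrite -ax ca.
  apply/eqP=> cla; apply: (no_common a); first by rewrite !inE ax.
    by apply: Nc_cl; rewrite ?inA.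
  by apply: Nc_cl; rewrite ?inA.
have oneN u : u \in A -> c -- u -> cl u = cl u1.
  move=> Au cu; have [_ _ clu] := nbr_core u Au cu.
  exact: (nbr_one_class cA (inA _ A1) cl1 noi).
have [b [Ab core_b cl1b]] := exit_block cA (inA _ A1) (inA _ A2) core_1 core_2 u12.
have nbr_k a u : core a -> cl a = cl b -> u \in A -> c -- u -> a -- u.
  move=> ca cla Au cu; have [_ core_u _] := nbr_core u Au cu.
  by apply: (core_adj lay) => //; rewrite cla (oneN u) // adj_sym.
have is_x a : a \in A -> core a -> cl a = cl b -> a = x.
  move=> Aa ca cla; apply/eqP/negPn/negP=> ax.
  by apply: (no_common a); rewrite ?inE ?ax //; apply: nbr_k => //; apply: inA.
have bx := is_x b Ab core_b erefl; rewrite {}bx in core_b cl1b nbr_k is_x.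
split=> // [u Au cu|u Au xu core_u clxu]; first by apply: nbr_k; rewrite ?inA.
suff clu : cl u = cl u1 by apply: (core_adj lay) => //; rewrite clu.
have [W [W1 xW WE]] := class_bridge lay cl1b.
have [Wu|uW] := boolP (cl u \in W).
  by have [] := WE _ _ Wu xW (etrans (adj_sym _ _) clxu).
have [||t|a [a' []]] := rootedP _ _ rc [set a in A :\ x | cl a \notin W].
- by apply/subsetP=> a; rewrite inE => /andP[].
- by apply/set0Pn; exists u; rewrite inE Au.
- rewrite !inE => /andP[/andP[_ At]]; apply: contra => ct; by rewrite (oneN t).
rewrite inE => /andP[Aa aW] Aa'; rewrite inE Aa' /= negbK => Wa' aa'.
case: (adj_block lay aa') => [/(block_class lay) e|[ca ca' claa']].
  by rewrite e Wa' in aW.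
have [_ eqa] := WE _ _ Wa' aW (etrans (adj_sym _ _) claa').
by have := Aa; rewrite (is_x a (inA _ Aa) ca eqa) setD11.
Qed.

Lemma layout_decomposable : decomposable G.
Proof. by split; [apply: layout_nbr_joined | apply: layout_cut_twin]. Qed.

End LayoutDecomposable.

(** * The structure of B(T)-trees *)

(** The side of x consists of the vertices reachable from x without the edge xy;
    a path from x to y avoiding this edge would close up to a cycle. *)
Lemma acyclic_bridge (F : sgraph) (x y : F) : acyclic F -> x -- y -> bridge x y.
Proof.
move=> acF xy; pose e := [rel u v : F | [&& u -- v, (u, v) != (x, y) & (u, v) != (y, x)]].
have nxy : ~~ connect e x y.
  apply/negP=> /connectP[p ep]; case: (shortenP ep) => {ep} p ep Up _ lastp.
  have := acF (x :: p) Up; rewrite /= rcons_path -lastp adj_sym xy andbT.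
  rewrite (sub_path _ ep) => [/(_ isT)|u v /and3P[]//].
  case: p ep lastp {Up} => [_ yx|z [|//]] /=; first by rewrite yx adj_irr in xy.
  by move=> + yz; rewrite -yz eqxx andbF.
exists [set z | connect e x z]; split=> [||a b]; rewrite !inE ?connect0 //.
move=> xa xb ab; have neab : ~~ e a b.
  by apply: contra xb => eab; apply: connect_trans xa _; apply: connect1.
move: neab; rewrite /= ab /= negb_and !negbK => /orP[/eqP[-> ->]//|/eqP[ay bx]].
by rewrite -ay xa in nxy.
Qed.

(** The retraction [pr] of an H-tree onto one of its trees, which sends all other
    vertices to the root, contracts all edges but those of this tree. *)
Lemma htree_bridge (H : sgraph) (Tr : H -> sgraph) (r : forall i, Tr i) b (x y : Tr b) :
  bridge x y -> bridge (Tagged Tr x : htree r) (Tagged Tr y : htree r).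
Proof.
case=> W [Wx yW WE].
pose pr (z : htree r) : Tr b := tagged_as (Tagged Tr (r b)) z.
have prE (u : Tr b) : pr (Tagged Tr u) = u by rewrite /pr tagged_asE.
have pr_root i : pr (Tagged Tr (r i)) = r b.
  have [ib|ib] := eqVneq i b; first by case: b / ib x y W Wx yW WE pr prE.
  by rewrite /pr /tagged_as /=; case: eqP => // bi; rewrite bi eqxx in ib.
exists [set z | pr z \in W]; split=> [||[i a] [j a']]; rewrite !inE ?prE //.
rewrite {1}/adj /= /htree_adj /= => Wa a'W /orP[/andP[/eqP ij]|]; last first.
  case/and3P=> /eqP ea /eqP ea' _; move: Wa a'W.
  by rewrite ea ea' !pr_root => ->.
case: j / ij a' a'W => a' a'W; rewrite tagged_asE => aa'.
have [ib|ib] := eqVneq b i; last first.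
  have pr_out (u : Tr i) : pr (Tagged Tr u) = r b.
    by rewrite /pr /tagged_as /=; case: eqP => // bi; rewrite bi eqxx in ib.
  by rewrite !pr_out in Wa a'W; rewrite Wa in a'W.
case: i / ib a a' Wa a'W aa' => a a'; rewrite !prE => Wa a'W aa'.
by have [-> ->] := WE a a' Wa a'W aa'.
Qed.

Section HTreeLayout.
Variables (T B G : sgraph) (V : T -> finType) (Tr : B -> sgraph) (r : forall i, Tr i).
Variables (g : B -> blowup V) (f : G -> htree r).
Hypotheses (g_adj : forall i j, (g i -- g j) = (i -- j)).
Hypotheses (f_bij : bijective f) (f_adj : forall u v, (f u -- f v) = (u -- v)).
Hypotheses (acT : acyclic T) (acTr : forall i, acyclic (Tr i)).

Definition block v : B := tag (f v).
Definition is_root v : bool := tagged (f v) == r (block v).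
Definition class v : T := tag (g (block v)).

Lemma htree_layout : layout block is_root class.
Proof.
split.
- move=> u v /eqP ru /eqP rv bk_uv; apply: (bij_inj f_bij).
  move: ru rv bk_uv; rewrite /block.
  case: (f u) (f v) => [i x] [j y] /= + + ij.
  by case: j / ij y => y -> ->.
- by rewrite /class => u v ->.
- move=> u v; rewrite -f_adj => /orP[/andP[/eqP]|/and3P[ru rv]]; first by left.
  by rewrite -g_adj; right.
- move=> u v ru rv cuv; rewrite -f_adj; apply/orP; right; apply/and3P; split=> //.
  by rewrite -g_adj.
- move=> u v uv bk_uv; have [f' fK f'K] := f_bij.
  have [W [Wu vW WE]] : bridge (f u) (f v).
    move: uv bk_uv; rewrite -f_adj /block.
    case: (f u) (f v) => [i x] [j y] /= + ij; case: j / ij y => y.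
    rewrite /adj /= /htree_adj /= tagged_asE eqxx adj_irr !andbF orbF => xy.
    exact/htree_bridge/acyclic_bridge.
  exists [set w | f w \in W]; split=> [||a b]; rewrite !inE //.
  rewrite -f_adj => Wa bW /(WE _ _ Wa bW)[fa fb].
  by split; apply: (bij_inj f_bij).
by move=> i j; apply: acyclic_bridge.
Qed.

End HTreeLayout.

Theorem theorem2 (R : realType) (T B G : sgraph) (w : G -> R)
    (treeT : is_tree T) (blowupB : is_blowup T B) (htreeG : is_htree B G)
    (connG : connected G) (evenG : ~~ odd #|G|)
    (w_ge0 : forall v : G, 0 <= w v) :
  alice_wins w.
Proof.
have [_ _ acT] := treeT; have [V [_ [g _ g_adj]]] := blowupB.
have [Tr [r [treeTr [f f_bij f_adj]]]] := htreeG.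
have acTr i : acyclic (Tr i) by case: (treeTr i).
have lay := htree_layout g_adj f_bij f_adj acT acTr.
apply: alice_wins_cval_ge0 => //; apply: cval_ge0.
- exact: layout_decomposable lay.
- by rewrite -connected_inE.
by rewrite cardsT.
Qed.
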